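(* Let $X$ be the set of all functions $f:\omega\to\{0,1,2\}$ whose support $\operatorname{supp}(f):=f^{-1}(\{0,1\})$ is non-empty and finite, endowed with the operation of coordinatewise minimum, $(f\cdot g)(i)=\min\{f(i),g(i)\}$; this is a countable semilattice. For $n\in\omega$ let $\mathbf 0_n,\mathbf 1_n\in X$ be defined by $\mathbf 0_n(n)=0$, $\mathbf 1_n(n)=1$, and $\mathbf 0_n(i)=\mathbf 1_n(i)=2$ for all $i\neq n$. Then $X$ admits a metrizable shift-continuous topology $\tau$ such that the set $\{(\mathbf 0_n,\mathbf 1_n):n\in\mathbb N\}$ is dense in $X\times X$ (with the product topology of $(X,\tau)\times(X,\tau)$). Since $\{(\mathbf 0_n,\mathbf 1_n)\}_{n\in\omega}\subset P:=\{(x,y)\in X\times X: xy=x\}\neq X\times X$, the partial order $P$ of $X$ is dense and non-closed in $X\times X$.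
   Context: A semilattice is a commutative semigroup all of whose elements are idempotents ($xx=x$). Its partial order is defined by $x\le y$ iff $xy=x$. A topology $\tau$ on a semilattice $X$ is shift-continuous if for every $a\in X$ the map $X\to X$, $x\mapsto ax$, is continuous with respect to $\tau$; equivalently, the operation $X\times X\to X$ is separately continuous, i.e. $(X,\tau)$ is a semitopological semilattice. Here $\omega=\{0,1,2,\dots\}$ and $\mathbb N=\{1,2,\dots\}$. *)

(* Defs.v *)
From HB Require Import structures.
From mathcomp Require Import all_boot all_order all_algebra.
From mathcomp Require Import all_classical all_reals all_analysis.

Set Implicit Arguments.
Unset Strict Implicit.
Unset Printing Implicit Defensive.

Import Order.TTheory GRing.Theory Num.Theory.

Local Open Scope classical_set_scope.
Local Open Scope ring_scope.

Definition semilattice (S : Type) (op : S -> S -> S) : Prop :=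
  [/\ associative op, commutative op & idempotent_op op].

Definition semilattice_order (S : Type) (op : S -> S -> S) : set (S * S) :=
  [set p | op p.1 p.2 = p.1].

Definition shift_continuous (T : topologicalType) (op : T -> T -> T) : Prop :=
  forall a : T, continuous (op a).

(* Some metric (nonnegativity follows from the listed axioms, exactly as in the
   library's factory isMetric) has its open balls as neighbourhood bases. *)
Definition metrizable (R : realType) (T : topologicalType) : Prop :=
  exists d : T -> T -> R,
    [/\ forall x, d x x = 0,
        forall x y, d x y = 0 -> x = y,
        forall x y, d x y = d y x,
        forall x y z, d x z <= d x y + d y z &
        forall x : T,
          nbhs x = filter_from [set e : R | 0 < e]
                               (fun e => [set y | d x y < e])].

Definition v0 : 'I_3 := @Ordinal 3 0 isT.
Definition v1 : 'I_3 := @Ordinal 3 1 isT.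
Definition v2 : 'I_3 := @Ordinal 3 2 isT.

Definition supp (f : nat -> 'I_3) : set nat := f @^-1` [set v0; v1].

(* A record rather than a subset of nat -> 'I_3, so that no canonical topology
   (such as the one induced by the product topology) is inferred on it. *)
Record fsfun3 : Type := Fsfun3 {
  fval :> nat -> 'I_3;
  fval_supp_neq0 : supp fval !=set0;
  fval_supp_fin : finite_set (supp fval)
}.

Definition min3 (f g : nat -> 'I_3) : nat -> 'I_3 :=
  fun i => Order.min (f i) (g i).

Lemma supp_min3 f g : supp (min3 f g) = supp f `|` supp g.
Proof.
have suppE h i : supp h i <-> (h i < 2)%N.
  rewrite /supp /=; split=> [[]-> //|].
  by case: (h i) => -[|[|m]] lt3 // _; [left|right]; exact/val_inj.
apply/seteqP; split=> i; rewrite /setU /= !suppE /min3;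
  case: leP => //; first by left.
- by right.
- by move=> le_fg [//|]; apply: leq_ltn_trans.
- by move=> /ltW le_gf [|//]; apply: leq_ltn_trans.
Qed.

Lemma supp_min3_neq0 (f g : fsfun3) : supp (min3 f g) !=set0.
Proof.
by rewrite supp_min3; have [i fi] := fval_supp_neq0 f; exists i; left.
Qed.

Lemma supp_min3_fin (f g : fsfun3) : finite_set (supp (min3 f g)).
Proof. by rewrite supp_min3 finite_setU; split; exact: fval_supp_fin. Qed.

Definition minX (f g : fsfun3) : fsfun3 :=
  Fsfun3 (supp_min3_neq0 f g) (supp_min3_fin f g).

Definition single (v : 'I_3) (n : nat) : nat -> 'I_3 :=
  fun i => if i == n then v else v2.

Lemma supp_single v n : v \in [set v0; v1] -> supp (single v n) = [set n].
Proof.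
rewrite inE => v01; apply/seteqP; split=> [i|_ ->]; rewrite /supp /single /=.
  by case: eqVneq => // _ [].
by rewrite eqxx.
Qed.

Lemma supp_single_neq0 v n :
  v \in [set v0; v1] -> supp (single v n) !=set0.
Proof. by move=> /supp_single ->; exists n. Qed.

Lemma supp_single_fin v n :
  v \in [set v0; v1] -> finite_set (supp (single v n)).
Proof. by move=> /supp_single ->; exact: finite_set1. Qed.

Lemma v0_in : v0 \in [set v0; v1]. Proof. by rewrite inE; left. Qed.
Lemma v1_in : v1 \in [set v0; v1]. Proof. by rewrite inE; right. Qed.

Definition zeroX (n : nat) : fsfun3 :=
  Fsfun3 (supp_single_neq0 n v0_in) (supp_single_fin n v0_in).

Definition oneX (n : nat) : fsfun3 :=
  Fsfun3 (supp_single_neq0 n v1_in) (supp_single_fin n v1_in).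

(* Main.v *)
(* Let every n serve either one pair (x, y) of elements of X or nothing, each
   choice being made for arbitrarily large n, and suppose that a function
   [color] satisfies color (a 0_n) = color (a x) and color (a 1_n) = color (a
   y) whenever n serves (x, y) and the supports of a, x and y lie below n. Call
   x and y N-close if color (a x) = color (a y) for all a supported below N.
   These equivalence relations decrease with N, hence generate an
   ultrametrizable topology; the shift by an element supported below K turns
   (max N K)-close points into N-close ones, so shifts are continuous; and
   (0_n, 1_n) with n serving (x, y) is as close to (x, y) as one wants. Such a
   [color] exists because a 0_n has n as the largest element of its support, so
   its color may be prescribed freely by recursion on that element. For the n
   serving nothing one puts color f = f: shifting by such 0_n shows that the
   topology separates points. *)
From HB Require Import structures.
Require Import Defs.
From mathcomp Require Import all_boot all_order all_algebra.
From mathcomp Require Import all_classical all_reals all_analysis.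
From mathcomp Require Import zify.

Set Implicit Arguments.
Unset Strict Implicit.
Unset Printing Implicit Defensive.

Import Order.TTheory GRing.Theory Num.Theory.

Local Open Scope classical_set_scope.
Local Open Scope ring_scope.

(** * A metric and its topology from a decreasing sequence of equivalence relations *)

Lemma separating_sequence_metric (R : realType) (T : Type)
    (A : nat -> T -> T -> Prop) :
    (forall n x, A n x x) ->
    (forall n x y, A n x y -> A n y x) ->
    (forall n x y z, A n x y -> A n y z -> A n x z) ->
    (forall m n x y, (m <= n)%N -> A n x y -> A m x y) ->
    (forall x y, (forall n, A n x y) -> x = y) ->
  exists d : T -> T -> R,
    [/\ forall x, d x x = 0,
        forall x y, d x y = 0 -> x = y,
        forall x y, d x y = d y x,
        forall x y z, d x z <= d x y + d y z &
        forall n x y, d x y < n.+1%:R^-1 <-> A n x y].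
Proof.
move=> Axx Asym Atrans Amono Asep.
(* The distance is [n.+1%:R^-1] for the least [n] at which [A n x y] fails, and 0 if there is
   none. *)
have dP (xy : T * T) : exists r : R,
    (r = 0 \/ exists n : nat, r = n.+1%:R^-1) /\
    forall n, r < n.+1%:R^-1 <-> A n xy.1 xy.2.
  case: xy => x y /=.
  have [all_A|/existsNP nA] := pselect (forall n, A n x y).
    by exists 0; split; [left | move=> n; rewrite invr_gt0 ltr0Sn].
  have exA : exists n, ~~ `[< A n x y >].
    by case: nA => n /asboolPn nAn; exists n.
  case: (ex_minnP exA) => n /asboolPn nAn min_n; exists n.+1%:R^-1.
  split=> [|m]; first by right; exists n.
  rewrite ltf_pV2 ?posrE ?ltr0Sn// ltr_nat ltnS; split=> [lt_mn|Am].
    by apply: contrapT => /asboolPn /min_n; rewrite leqNgt lt_mn.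
  by rewrite ltnNge; apply/negP => le_nm; exact/nAn/(Amono _ _ _ _ le_nm).
pose d x y := sval (cid (dP (x, y))).
have dA n x y : d x y < n.+1%:R^-1 <-> A n x y.
  by rewrite /d; case: cid => r [] /= _; exact.
have dval x y : d x y = 0 \/ exists n : nat, d x y = n.+1%:R^-1.
  by rewrite /d; case: cid => r [].
have d_ge0 x y : 0 <= d x y.
  by case: (dval x y) => [->|[n ->]] //; rewrite invr_ge0 ler0n.
(* As the only positive values are the thresholds [n.+1%:R^-1], a bound on [d] can be tested at
   these; symmetry and the triangle inequality then reduce to those of [A n]. *)
have d_le x y e : 0 <= e -> (forall n, e < n.+1%:R^-1 -> A n x y) -> d x y <= e.
  move=> e_ge0 eA; case: (dval x y) => [-> //|[n dn]].
  by rewrite leNgt; apply/negP; rewrite {1}dn => /eA /dA; rewrite dn ltxx.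
have d_sym x y : d x y = d y x.
  by apply/eqP; rewrite eq_le !d_le // => n /dA/Asym.
exists d; split=> //.
- by move=> x; apply/eqP; rewrite eq_le d_ge0 d_le.
- by move=> x y d0; apply: Asep => n; apply/dA; rewrite d0 invr_gt0 ltr0Sn.
- move=> x y z; apply: d_le => [|n lt_n]; first exact: addr_ge0.
  apply: (Atrans _ _ y); apply/dA; apply: le_lt_trans lt_n.
    by rewrite lerDl.
  by rewrite lerDr.
Qed.

Lemma metric_topology (R : realType) (T : Type) (d : T -> T -> R) :
    (forall x, d x x = 0) ->
    (forall x y, d x y = 0 -> x = y) ->
    (forall x y, d x y = d y x) ->
    (forall x y z, d x z <= d x y + d y z) ->
  exists tau : Topological.axioms_ T, forall x,
    @nbhs (Topological.Pack tau) (Topological.Pack tau) x =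
    filter_from [set e : R | 0 < e] (fun e => [set y | d x y < e]).
Proof.
move=> dxx dpos dsym dtri.
have dtri' y x z : d x z <= d x y + d y z by exact: dtri.
(* [{classic T}] equips the bare type [T] with a classical choice structure. *)
pose Mmix := isMetric.Build R {classic T} dxx dpos dsym dtri'.
pose M : metricType R := HB.pack_for (metricType R) {classic T} Mmix.
exists (Topological.class M) => x.
have -> : @nbhs M M x = @nbhs_ball R M x by rewrite nbhs_ballE.
by [].

Qed.

Lemma separating_sequence_topology (R : realType) (T : Type)
    (A : nat -> T -> T -> Prop) :
    (forall n x, A n x x) ->
    (forall n x y, A n x y -> A n y x) ->
    (forall n x y z, A n x y -> A n y z -> A n x z) ->
    (forall m n x y, (m <= n)%N -> A n x y -> A m x y) ->
    (forall x y, (forall n, A n x y) -> x = y) ->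
  exists tau : Topological.axioms_ T, let X := Topological.Pack tau in
    metrizable R X /\
    forall (x : X) (B : set X), nbhs x B <-> exists n, A n x `<=` B.
Proof.
move=> Axx Asym Atrans Amono Asep.
have [d [dxx dpos dsym dtri dA]] :=
  separating_sequence_metric R Axx Asym Atrans Amono Asep.
have [tau nbhsE] := metric_topology dxx dpos dsym dtri.
exists tau => X; split=> [|x B]; first by exists d; split.
rewrite nbhsE; split=> [[e e_gt0 sB]|[n sB]]; last first.
  by exists n.+1%:R^-1 => [|y /dA /sB//]; rewrite /= invr_gt0 ltr0Sn.
have [N _ ltN] := near_infty_natSinv_lt (PosNum e_gt0).
by exists N => y /dA dxy; apply/sB/(lt_trans dxy)/ltN => /=.
Qed.

(** * Finitely supported functions, their coding and their coloring *)

Local Open Scope nat_scope.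

Definition supp_below (N : nat) (f : nat -> 'I_3) : Prop :=
  forall i, N <= i -> f i = v2.

Lemma supp_belowW M N f : M <= N -> supp_below M f -> supp_below N f.
Proof. by move=> le_MN fM i /(leq_trans le_MN)/fM. Qed.

Lemma min3v2 (v : 'I_3) : Order.min v v2 = v.
Proof. by apply/min_idPl; case: v => m lt_m3; rewrite leEord/= -ltnS. Qed.

Lemma min3A : associative min3.
Proof. by move=> f g h; apply/funext => i; rewrite /min3 minA. Qed.

Lemma min3C : commutative min3.
Proof. by move=> f g; apply/funext => i; rewrite /min3 minC. Qed.

Lemma supp_below_min3 N f g :
  supp_below N f -> supp_below N g -> supp_below N (min3 f g).
Proof. by move=> fN gN i le_Ni; rewrite /min3 fN ?gN ?min3v2. Qed.

Lemma supp_below_single v n : supp_below n.+1 (single v n).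
Proof. by move=> i lt_ni; rewrite /single gtn_eqF. Qed.

Lemma finite_supp_below (f : nat -> 'I_3) :
  finite_set (supp f) -> exists N, supp_below N f.
Proof.
move=> /finite_seqP [s sE]; exists (\max_(i <- s) i).+1 => i lt_i.
have /negP : i \notin s.
  by apply/negP => i_s; rewrite ltnNge leq_bigmax_seq in lt_i.
have -> : i \in s <-> supp f i by rewrite sE.
rewrite /supp /=; case: (f i) => -[|[|[|m]]] lt_m3 // nf; last exact: val_inj.
- by case: nf; left; apply: val_inj.
- by case: nf; right; apply: val_inj.
Qed.

Lemma nth_mkseq_below N f : supp_below N f -> nth v2 (mkseq f N) = f.
Proof.
move=> fN; apply/funext => i; have [lt_iN|le_Ni] := ltnP i N.
  by rewrite nth_mkseq.
by rewrite nth_default ?size_mkseq// fN.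
Qed.

Lemma fsfun3_inj (x y : fsfun3) : (x : nat -> 'I_3) = y -> x = y.
Proof.
case: x y => [f f0 fF] [g g0 gF] /= eq_fg; subst g.
by rewrite (Prop_irrelevance f0 g0) (Prop_irrelevance fF gF).
Qed.

(* The [logn 2] takes every value infinitely often, so each pair of functions,
   coded by finite sequences, and also [None], is the task of infinitely many
   n. *)
Definition task (n : nat) : option (seq 'I_3 * seq 'I_3) :=
  if unpickle (logn 2 n) is Some t then t else None.

Lemma taskP (t : option (seq 'I_3 * seq 'I_3)) N :
  exists2 n, N < n & task n = t.
Proof.
(* The odd factor pushes the witness above [N] without changing its 2-adic valuation [pickle t]. *)
exists (2 ^ pickle t * (2 * N).+1).
  have : 0 < 2 ^ pickle t by rewrite expn_gt0.
  by nia.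
rewrite /task lognM ?expn_gt0// lognX logn_prime// eqxx muln1.
have -> : logn 2 (2 * N).+1 = 0.
  by rewrite lognE dvdn2 /= mul2n odd_double.
by rewrite addn0 pickleK.
Qed.

(** In the recursion, this deletes the largest support element [n] and whatever a decoded sequence
    carries beyond it. *)
Definition trunc (n : nat) (f : nat -> 'I_3) (i : nat) : 'I_3 :=
  if i < n then f i else v2.

(* [N] bounds the support of [f]; the first branch descends to its largest
   element. *)
Fixpoint color_below (N : nat) (f : nat -> 'I_3) : nat -> 'I_3 :=
  if N isn't n.+1 then f else
  if f n == v2 then color_below n f else
  if task n is Some (s, t) then
    color_below n (trunc n (min3 f (nth v2 (if f n == v0 then s else t))))
  else f.

Lemma color_below_stable M N f :
  supp_below M f -> M <= N -> color_below N f = color_below M f.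
Proof.
move=> fM /subnKC <-; elim: (N - M) => [|k IHk]; first by rewrite addn0.
by rewrite addnS /= fM ?eqxx// leq_addr.
Qed.

(** By [color_below_stable] the choice of the bound is immaterial; 0 is a dummy for infinite
    supports. *)
Definition color (f : nat -> 'I_3) : nat -> 'I_3 :=
  color_below (xget 0 [set N | supp_below N f]) f.

Lemma colorE N f : supp_below N f -> color f = color_below N f.
Proof.
move=> fN; rewrite /color; set M := xget _ _.
have fM : supp_below M f by apply: (@xgetI _ 0 [set K | supp_below K f]) fN.
by have [le_MN|/ltnW le_NM] := leqP M N;
  [rewrite (color_below_stable fM le_MN)|
   rewrite (color_below_stable fN le_NM)].
Qed.

(** The largest support element is [n], with value [v], so the recursion multiplies by [u];
    truncation then erases [single v n] and leaves [min3 a u]. *)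
Lemma color_min3_single n s t (v : 'I_3) a :
    task n = Some (s, t) -> v <> v2 ->
    let u := nth v2 (if v == v0 then s else t) in
    supp_below n u -> supp_below n a ->
  color (min3 a (single v n)) = color (min3 a u).
Proof.
move=> task_n vNv2 u un an.
have vn : min3 a (single v n) n = v.
  by rewrite /min3 /single eqxx an// minC min3v2.
rewrite (@colorE n.+1); last first.
  apply: supp_below_min3; first exact: supp_belowW an.
  exact: supp_below_single.
rewrite /= vn (negbTE (introN eqP vNv2)) task_n -/u.
rewrite (colorE (supp_below_min3 an un)); congr color_below.
apply/funext => i; rewrite /trunc; case: ltnP => [lt_in|le_ni].
  by rewrite /min3 /single (ltn_eqF lt_in) min3v2.
by rewrite /min3 an// un// min3v2.
Qed.

Lemma color_free n f : task n = None -> supp_below n.+1 f -> f n != v2 ->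
  color f = f.
Proof. by move=> fr fn nf; rewrite (colorE fn) /= (negbTE nf) fr. Qed.

(* The functions [a] range over X together with the constant [v2], which acts
   as the identity. *)
Definition agree (N : nat) (x y : fsfun3) : Prop :=
  forall a, supp_below N a -> color (min3 a x) = color (min3 a y).

Lemma fsfun3_bound (x : fsfun3) : exists N, supp_below N x.
Proof. exact/finite_supp_below/fval_supp_fin. Qed.

Lemma agree_separating x y : (forall N, agree N x y) -> x = y.
Proof.
move=> xy; apply/fsfun3_inj/funext => i.
have [M xM] := fsfun3_bound x; have [N yN] := fsfun3_bound y.
(* With [n] above [i], multiplying by [single v0 n] leaves coordinate [i] intact. *)
have [n lt_n free_n] := taskP None (maxn i (maxn M N)).
have zn (z : fsfun3) K : supp_below K z -> K <= n ->
    color (min3 (single v0 n) z) = min3 (single v0 n) z.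
  move=> zK le_Kn; apply: (color_free free_n).
    apply: supp_below_min3; first exact: supp_below_single.
    by apply: supp_belowW zK; exact: leqW.
  by rewrite /min3 /single eqxx zK// min3v2.
have := xy n.+1 _ (@supp_below_single v0 n).
rewrite (zn x M) ?(zn y N)//; try lia.
move=> /(congr1 (@^~ i)); rewrite /min3 /single ltn_eqF; last lia.
by rewrite ![Order.min v2 _]minC !min3v2.
Qed.

Lemma agree_minX N K (a x y : fsfun3) :
  supp_below K a -> agree (maxn N K) x y -> agree N (minX a x) (minX a y).
Proof.
move=> aK xy b bN; rewrite /= !min3A; apply: xy; apply: supp_below_min3.
  exact: supp_belowW (leq_maxl _ _) bN.
exact: supp_belowW (leq_maxr _ _) aK.
Qed.

Lemma agree_zero_one_dense M N x y :
  exists n, [/\ 0 < n, agree M x (zeroX n) & agree N y (oneX n)].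
Proof.
have [K xK] := fsfun3_bound x; have [L yL] := fsfun3_bound y.
(* The bounds [K], [L] put [x], [y] below [n], and [M], [N] do so for the test functions [a]. *)
have [n lt_n task_n] := taskP (Some (mkseq x K, mkseq y L))
  (maxn (maxn K L) (maxn M N)).
exists n; split=> [|a aM|a aN]; first lia.
- rewrite /= (color_min3_single task_n) /= ?nth_mkseq_below//.
    by apply: supp_belowW xK; lia.
  by apply: supp_belowW aM; lia.
- rewrite /= (color_min3_single task_n) /= ?nth_mkseq_below//.
    by apply: supp_belowW yL; lia.
  by apply: supp_belowW aN; lia.
Qed.

(** * The semilattice, its order and its topology *)

Lemma minX_semilattice : semilattice minX.
Proof.
split=> [x y z|x y|x]; apply: fsfun3_inj => /=.
- exact: min3A.
- exact: min3C.
- by apply/funext => i; rewrite /min3 minxx.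
Qed.

Lemma countable_fsfun3 : countable [set: fsfun3].
Proof.
have [b bP] : {b : fsfun3 -> nat | forall x, supp_below (b x) x}.
  by exists (fun x => sval (cid (fsfun3_bound x))) => x; case: cid.
apply/countable_injP; exists (fun x : fsfun3 => pickle (mkseq x (b x))).
move=> x y _ _ /(pcan_inj pickleK) eq_xy; apply: fsfun3_inj.
by rewrite -(nth_mkseq_below (bP x)) eq_xy nth_mkseq_below.
Qed.

Lemma zero_one_le n : semilattice_order minX (zeroX n, oneX n).
Proof.
apply: fsfun3_inj; apply/funext => i; rewrite /= /min3 /single.
by case: eqP => //; rewrite minxx.
Qed.

Lemma semilattice_order_neqT :
  semilattice_order minX <> [set: fsfun3 * fsfun3].
Proof.
(* At coordinate 0 the product has value 0, but [oneX 0] has value 1. *)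
move=> /seteqP [_ /(_ (oneX 0, zeroX 0) I)].
by move=> /(congr1 (fun x : fsfun3 => x 0)).
Qed.

Local Close Scope nat_scope.

Theorem theorem6p1 (R : realType) :
  [/\ semilattice minX,
      countable [set: fsfun3],
      [set (zeroX n, oneX n) | n in [set: nat]] `<=` semilattice_order minX,
      semilattice_order minX <> [set: fsfun3 * fsfun3] &
      exists tau : Topological.axioms_ fsfun3,
        let X : topologicalType := Topological.Pack tau in
        [/\ metrizable R X,
            @shift_continuous X minX,
            dense ([set (zeroX n, oneX n) | n in [set n | (0 < n)%N]]
                   : set (X * X)%type),
            dense (semilattice_order minX : set (X * X)%type) &
            ~ closed (semilattice_order minX : set (X * X)%type)]].
Proof.
have le01 : [set (zeroX n, oneX n) | n in [set: nat]] `<=`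
    semilattice_order minX by move=> _ [n _ <-]; exact: zero_one_le.
split=> //; [exact: minX_semilattice|exact: countable_fsfun3|
             exact: semilattice_order_neqT|].
have [||||| tau [metrX nbhsX]] := @separating_sequence_topology R fsfun3 agree.
- by [].
- by move=> n x y xy a an; rewrite (xy a an).
- by move=> n x y z xy yz a an; rewrite (xy a an) (yz a an).
- by move=> m n x y le_mn xy a am; apply: xy; exact: supp_belowW am.
- exact: agree_separating.
exists tau => X.
have dense01 : dense ([set (zeroX n, oneX n) | n in [set n | (0 < n)%N]]
                      : set (X * X)%type).
  move=> O [[x y] Oxy] openO.
  have [[/= U V] [/nbhsX [M sU] /nbhsX [N sV]] sUV] : nbhs (x, y) O.
    exact: open_nbhs_nbhs.
  have [n [n_gt0 xn yn]] := agree_zero_one_dense M N x y.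
  exists (zeroX n, oneX n); split; last by exists n.
  by apply: sUV; split; [exact: sU | exact: sV].
have denseP : dense (semilattice_order minX : set (X * X)%type).
  move=> O O0 /(dense01 _ O0) [p [Op [n _ np]]].
  by exists p; split=> //; apply: le01; exists n.
split=> //.
- move=> a x B /nbhsX [N sB]; have [K aK] := fsfun3_bound a.
  by apply/nbhsX; exists (maxn N K) => y /(agree_minX aK)/sB.
(* Were the order closed, its complement would be open and non-empty, hence would meet the dense
   order. *)
- move=> closedP; apply: semilattice_order_neqT; apply/seteqP; split=> // p _.
  apply: contrapT => nPp.
  have [] := denseP (~` (semilattice_order minX : set (X * X)%type)).
  + by exists p.
  + exact: closed_openC.
  + by move=> q [].
Qed.
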